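(* Let $D_1(x,y,q)$ be the generating series of $d_1$-symmetric parallelogram polyominoes, with $x$, $y$, $q$ marking the width, the height and the area, and for each $k\ge0$ let $r_k(q)$ be the area generating polynomial of the $r^2$-symmetric parallelogram polyominoes of half-perimeter $k$. Then $$D_1(t,t,q)=\sum_{k\ge0}r_{2k}(q)\,t^{2k}.$$ Equivalently, every $d_1$-symmetric parallelogram polyomino has even half-perimeter and, for all $k$ and $a$, there is a bijection between $d_1$-symmetric parallelogram polyominoes of half-perimeter $2k$ and area $a$ and $r^2$-symmetric parallelogram polyominoes of half-perimeter $2k$ and area $a$.
   Context: A parallelogram polyomino is a finite nonempty connected set of unit cells of the square lattice, considered up to translation, whose intersection with every row and every column of cells is a contiguous block (or empty), and which contains the bottom-left and the top-right cells of its minimal bounding rectangle. Equivalently, with columns numbered $1,\dots,w$ from left to right, column $i$ occupies the rows $b_i,\dots,t_i$ with $b_i\le b_{i+1}\le t_i\le t_{i+1}$ for $1\le i<w$. The half-perimeter is the sum of the width and the height of the minimal bounding rectangle; the area is the number of cells. Let $r^2$ be the rotation by $180^\circ$ and $d_1$ the reflection about a line parallel to the bisector of the second quadrant (direction $y=-x$). A polyomino is $g$-symmetric if it equals, up to translation, its image under $g$. *)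

(* Defs.v *)
From HB Require Import structures.
From mathcomp Require Import all_boot all_order all_algebra.
From mathcomp Require Import finmap generic_quotient.
From mathcomp Require Import boolp classical_sets functions cardinality fsbigop.

Set Implicit Arguments.
Unset Strict Implicit.
Unset Printing Implicit Defensive.

Import Order.TTheory GRing.Theory Num.Theory.
Local Open Scope ring_scope.
Local Open Scope quotient_scope.

(* A unit cell of the square lattice is identified with its centre, in
   coordinates where the centres are the points of Z^2: (abscissa, ordinate). *)
Notation cell := (int * int)%type.

Implicit Types (P Q : {fset cell}) (c d v : cell).

Definition translate v P : {fset cell} := [fset (c + v)%R | c in P]%fset.

Definition transl_equiv P Q : bool := `[< exists v, Q = translate v P >].

Lemma transl_equiv_refl : reflexive transl_equiv.
Proof.
move=> P; apply/asboolP; exists 0; apply/fsetP => c.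
apply/idP/imfsetP => [cP | [d dP ->]]; last by rewrite addr0.
by exists c; rewrite ?addr0.
Qed.

Lemma translateD v w P : translate w (translate v P) = translate (v + w) P.
Proof.
apply/fsetP => c; apply/imfsetP/imfsetP => [[_ /imfsetP[d dP ->] ->] | [d dP ->]].
  by exists d; rewrite ?addrA.
by exists (d + v); rewrite ?addrA //; apply/imfsetP; exists d.
Qed.

Lemma translate0 P : translate 0 P = P.
Proof.
apply/fsetP => c; apply/imfsetP/idP => [[d dP ->] | cP]; first by rewrite addr0.
by exists c; rewrite ?addr0.
Qed.

Lemma transl_equiv_sym : symmetric transl_equiv.
Proof.
suff H P Q : transl_equiv P Q -> transl_equiv Q P by move=> P Q; apply/idP/idP; apply: H.
move=> /asboolP[v ->]; apply/asboolP; exists (- v).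
by rewrite translateD subrr translate0.
Qed.

Lemma transl_equiv_trans : transitive transl_equiv.
Proof.
move=> Q P S /asboolP[v ->] /asboolP[w ->]; apply/asboolP; exists (v + w).
by rewrite translateD.
Qed.

Canonical transl_equiv_rel :=
  EquivRel transl_equiv transl_equiv_refl transl_equiv_sym transl_equiv_trans.

(* Finite sets of cells up to translation. All the notions on [figure] below
   are notions on finite sets of cells that are invariant under translation,
   read off the representative [repr F]. *)
Definition figure := {eq_quot transl_equiv}.
HB.instance Definition _ : EqQuotient _ transl_equiv figure :=
  EqQuotient.on figure.
HB.instance Definition _ := Choice.on figure.

(* Extremal values of a sequence of integers; meaningful when it is not empty. *)
Definition seq_min (s : seq int) : int := \big[Order.min/head 0 s]_(x <- s) x.
Definition seq_max (s : seq int) : int := \big[Order.max/head 0 s]_(x <- s) x.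

(* The minimal bounding rectangle of P consists of the cells (x, y) with
   xmin P <= x <= xmax P and ymin P <= y <= ymax P. *)
Definition xmin P := seq_min [seq c.1 | c <- P].
Definition xmax P := seq_max [seq c.1 | c <- P].
Definition ymin P := seq_min [seq c.2 | c <- P].
Definition ymax P := seq_max [seq c.2 | c <- P].

Definition adjacent : rel cell :=
  fun c d => `|c.1 - d.1| + `|c.2 - d.2| == 1.

Definition connected_cells P : Prop :=
  forall c d, c \in P -> d \in P ->
    exists s : seq cell, [/\ path adjacent c s, last c s = d & {subset s <= P}].

Definition row_convex P : Prop :=
  forall x1 x x2 y : int, (x1, y) \in P -> (x2, y) \in P ->
    x1 <= x <= x2 -> (x, y) \in P.

Definition column_convex P : Prop :=
  forall x y1 y y2 : int, (x, y1) \in P -> (x, y2) \in P ->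
    y1 <= y <= y2 -> (x, y) \in P.

Record parallelogram_cells P : Prop := ParallelogramCells {
  parallelogram_nonempty : P != fset0;
  parallelogram_connected : connected_cells P;
  parallelogram_row_convex : row_convex P;
  parallelogram_column_convex : column_convex P;
  parallelogram_bottom_left : (xmin P, ymin P) \in P;
  parallelogram_top_right : (xmax P, ymax P) \in P
}.

Definition parallelogram : set figure :=
  [set F | parallelogram_cells (repr F)].

Definition width (F : figure) : nat := `|(xmax (repr F) - xmin (repr F) + 1)%R|%N.
Definition height (F : figure) : nat := `|(ymax (repr F) - ymin (repr F) + 1)%R|%N.
Definition half_perimeter (F : figure) : nat := (width F + height F)%N.
Definition area (F : figure) : nat := #|` repr F|.

(* Linear parts of the isometries: the choice of the rotation centre, or of the
   axis among its parallels, is immaterial up to translation. *)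
Definition r2 c : cell := (- c.1, - c.2).
Definition d1 c : cell := (- c.2, - c.1).

Definition symmetric_under (g : cell -> cell) : set figure :=
  [set F | transl_equiv (g @` repr F)%fset (repr F)].

(* Area generating polynomial of a finite set of figures. *)
Definition area_poly (A : set figure) : {poly int} :=
  \sum_(F \in A) ('X^(area F) : {poly int}).

(* The coefficient of x^w y^h, a polynomial in q, of the generating series
   D_1(x, y, q). *)
Definition D1 (w h : nat) : {poly int} :=
  area_poly [set F : figure | [/\ parallelogram F, symmetric_under d1 F,
                                  width F = w & height F = h]]%classic.

(* The coefficient of t^n in G(t, t, q), for G(x, y, q) given by its
   coefficients. *)
Definition subst_tt (G : nat -> nat -> {poly int}) (n : nat) : {poly int} :=
  \sum_(i < n.+1) G i (n - i)%N.

Definition r (k : nat) : {poly int} :=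
  area_poly [set F : figure | [/\ parallelogram F, symmetric_under r2 F
                                & half_perimeter F = k]]%classic.

(* Main.v *)
Require Import Defs.
From HB Require Import structures.
From mathcomp Require Import all_boot all_order all_algebra.
From mathcomp Require Import finmap generic_quotient.
From mathcomp Require Import boolp classical_sets functions cardinality fsbigop.
From mathcomp Require Import zify.
Import Order.TTheory GRing.Theory Num.Theory.
Local Open Scope ring_scope.

(** A parallelogram polyomino is cut into its antidiagonals, the sets of cells
    of constant level x + y. Each antidiagonal is a contiguous block, the
    lowest and the highest ones are single cells, and each other cell has a
    neighbour one level down (west or south) and one level up (east or north).
    These properties, gathered in [staircase], characterise parallelogram
    polyominoes ([staircase_of_parallelogram], [parallelogram_of_staircase]),
    and the half-perimeter is the number of levels plus one.

    When the half-perimeter is even there is a middle antidiagonal. The twist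
    keeps the cells up to the middle level and reflects the cells above it in
    the perpendicular bisector of the middle block, a line of direction y = x.
    This reflection preserves levels, exchanges west with south and east with
    north, and maps the middle block to itself; the two halves therefore still
    fit together and the result is again a staircase ([twist_staircase]). It
    has as many cells, the same half-perimeter and the same middle block, so
    that the twist is an involution ([twistK]).

    A reflection of linear part [d1] that preserves the polyomino exchanges the
    two halves and fixes the middle level pointwise; a half-turn that preserves
    it exchanges the two halves and reverses the middle block. The composite of
    either map with the reflection used in the twist is the other one. Hence
    the twist of a [d1]-symmetric polyomino is [r2]-symmetric and conversely
    ([twist_d1], [twist_r2]). All this commutes with translations, hence
    descends to figures ([twist_figure_bij]). Finally a [d1]-symmetric
    polyomino is as wide as it is high ([d1_square]), so that its half-perimeter
    is even and only the coefficients of x^k y^k in D_1 are nonzero. *)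

Implicit Types (P : {fset cell}) (c d u v m M p : cell) (s : seq int).

(** * Bounding rectangles *)

Lemma seq_min_in s : s != [::] -> seq_min s \in s.
Proof.
case: s => // a s _; rewrite /seq_min /= big_seq.
apply: (big_ind (fun x => x \in a :: s)) => //; first exact: mem_head.
by move=> x y xs ys; rewrite /Order.min; case: ifP.
Qed.

Lemma seq_max_in s : s != [::] -> seq_max s \in s.
Proof.
case: s => // a s _; rewrite /seq_max /= big_seq.
apply: (big_ind (fun x => x \in a :: s)) => //; first exact: mem_head.
by move=> x y xs ys; rewrite /Order.max; case: ifP.
Qed.

Lemma seq_min_le s x : x \in s -> seq_min s <= x.
Proof.
rewrite /seq_min; elim: s {1}(head 0 s) => // a s IHs h.
rewrite big_cons inE ge_min => /predU1P[-> | /IHs ->]; first by rewrite lexx.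
exact: orbT.
Qed.

Lemma seq_max_ge s x : x \in s -> x <= seq_max s.
Proof.
rewrite /seq_max; elim: s {1}(head 0 s) => // a s IHs h.
rewrite big_cons inE le_max => /predU1P[-> | /IHs ->]; first by rewrite lexx.
exact: orbT.
Qed.

Lemma map_fset_nil P (f : cell -> int) : P != fset0 -> [seq f c | c <- P] != [::].
Proof.
case/fset0Pn => c cP; apply/eqP => /(congr1 (fun s => f c \in s)).
by rewrite map_f.
Qed.

Lemma bounds_le P c : c \in P ->
  [/\ xmin P <= c.1, c.1 <= xmax P, ymin P <= c.2 & c.2 <= ymax P].
Proof.
by move=> cP; split; first [apply: seq_min_le | apply: seq_max_ge];
  apply: map_f.
Qed.

Lemma bounds_attained P : P != fset0 ->
  [/\ exists2 c : cell, c \in P & c.1 = xmin P, exists2 c : cell, c \in P & c.1 = xmax P,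
      exists2 c : cell, c \in P & c.2 = ymin P & exists2 c : cell, c \in P & c.2 = ymax P].
Proof.
move=> P0; split.
- by have /mapP[c] := seq_min_in _ (map_fset_nil P fst P0); exists c.
- by have /mapP[c] := seq_max_in _ (map_fset_nil P fst P0); exists c.
- by have /mapP[c] := seq_min_in _ (map_fset_nil P snd P0); exists c.
- by have /mapP[c] := seq_max_in _ (map_fset_nil P snd P0); exists c.
Qed.

Lemma bounds_unique P m M : m \in P -> M \in P ->
    (forall c, c \in P -> m.1 <= c.1 <= M.1 /\ m.2 <= c.2 <= M.2) ->
  [/\ xmin P = m.1, xmax P = M.1, ymin P = m.2 & ymax P = M.2].
Proof.
move=> mP MP boxP; have P0 : P != fset0 by apply/fset0Pn; exists m.
have [a1 a2 a3 a4] := bounds_le P m mP; have [b1 b2 b3 b4] := bounds_le P M MP.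
have [[a aP ea] [b bP eb] [c cP ec] [d dP ed]] := bounds_attained P P0.
have := boxP a aP; have := boxP b bP; have := boxP c cP; have := boxP d dP.
by split; lia.
Qed.

Lemma cell_eq c d : c.1 = d.1 -> c.2 = d.2 -> c = d.
Proof. by case: c d => [? ?] [? ?] /= -> ->. Qed.

(** * Staircase structure *)

Definition level c : int := c.1 + c.2.

(** A path of cells can leave the open quadrant with apex [p] and directions
    [e1], [e2] only through one of the two open half-lines that bound it; when
    these contain no cell of [P], connectedness keeps all of [P] on one side. *)
Lemma quadrant_trap P p (e1 e2 : int) : connected_cells P ->
    e1 = 1 \/ e1 = -1 -> e2 = 1 \/ e2 = -1 ->
    (forall u, u \in P -> u.1 = p.1 -> e2 * (u.2 - p.2) <= 0) ->
    (forall u, u \in P -> u.2 = p.2 -> e1 * (u.1 - p.1) <= 0) ->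
  forall c d, c \in P -> d \in P ->
    0 < e1 * (c.1 - p.1) -> 0 < e2 * (c.2 - p.2) ->
    0 < e1 * (d.1 - p.1) /\ 0 < e2 * (d.2 - p.2).
Proof.
move=> conP he1 he2 col row c d cP dP c1 c2.
have [s [cs <- sP]] := conP c d cP dP.
elim: s c cs sP c1 c2 {cP dP} => [|u s IHs] c //= /andP[cu us] sP c1 c2.
have uP : u \in P by apply: sP; rewrite mem_head.
have [coln rown] := (col u uP, row u uP).
move: cu; rewrite /adjacent => cu.
apply: IHs => //; first by move=> w ws; apply: sP; rewrite inE ws orbT.
all: by case: he1 he2 => ? [] ?; subst; lia.
Qed.

Lemma pair_in P c (x y : int) : c \in P -> c.1 = x -> c.2 = y -> (x, y) \in P.
Proof. by move=> cP <- <-; rewrite -surjective_pairing. Qed.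

(** Parallelogram polyominoes level by level. All the clauses but the
    extremal ones concern one or two consecutive antidiagonals, and the
    reflections in lines of direction y = x preserve levels: this is what makes
    the twist easy to control. *)
Record staircase m M P : Prop := Staircase {
  bottom_in : m \in P;
  top_in : M \in P;
  level_bounds : forall c, c \in P -> level m <= level c <= level M;
  bottom_unique : forall c, c \in P -> level c = level m -> c = m;
  top_unique : forall c, c \in P -> level c = level M -> c = M;
  step_down : forall c, c \in P -> level m < level c ->
    (c.1 - 1, c.2) \in P \/ (c.1, c.2 - 1) \in P;
  step_up : forall c, c \in P -> level c < level M ->
    (c.1 + 1, c.2) \in P \/ (c.1, c.2 + 1) \in P;
  antidiagonal_convex : forall c d (x : int), c \in P -> d \in P ->
    level c = level d -> c.1 <= x <= d.1 -> (x, level c - x) \in P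
}.

(** The clauses on neighbours and on antidiagonals come from [quadrant_trap]. If [c] had no neighbour one
    level down, convexity would empty the half-lines to the left of [c] and
    below [c], and [c] could not be connected to the bottom cell. If a cell [p]
    were missing between two cells [c] and [d] of an antidiagonal, then, by
    convexity, of the four half-lines from [p] one horizontal and one vertical
    would be empty; each of the four possible quadrants separates two of the
    cells [m], [M], [c], [d]. *)
Lemma staircase_of_parallelogram P : parallelogram_cells P ->
  staircase (xmin P, ymin P) (xmax P, ymax P) P.
Proof.
case=> P0 conP rowP colP mP MP.
set m := (xmin P, ymin P) in mP *; set M := (xmax P, ymax P) in MP *.
have box c : c \in P -> [/\ m.1 <= c.1, c.1 <= M.1, m.2 <= c.2 & c.2 <= M.2].
  by move=> /bounds_le.
have trap := quadrant_trap P _ _ _ conP.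
have between_col u v (y : int) : u \in P -> v \in P -> u.1 = v.1 -> u.2 <= y <= v.2 ->
    (u.1, y) \in P.
  move=> uP vP uv; apply: colP; first by rewrite -surjective_pairing.
  by rewrite uv -surjective_pairing.
have between_row u v (x : int) : u \in P -> v \in P -> u.2 = v.2 -> u.1 <= x <= v.1 ->
    (x, u.2) \in P.
  move=> uP vP uv; apply: rowP; first by rewrite -surjective_pairing.
  by rewrite uv -surjective_pairing.
split=> //.
- by move=> c /box[]; rewrite /level; lia.
- by move=> c /box[? ? ? ?] lc; apply: cell_eq; move: lc; rewrite /level; lia.
- by move=> c /box[? ? ? ?] lc; apply: cell_eq; move: lc; rewrite /level; lia.
- move=> c cP lc; apply: contrapT => /not_orP[/negP left /negP below].
  have [mc1 _ mc2 _] := box c cP.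
  have col u : u \in P -> u.1 = c.1 -> -1 * (u.2 - c.2) <= 0.
    move=> uP uc; rewrite leNgt; apply: contra below => h.
    by rewrite -uc; apply: (between_col u c) => //; lia.
  have row u : u \in P -> u.2 = c.2 -> -1 * (u.1 - c.1) <= 0.
    move=> uP uc; rewrite leNgt; apply: contra left => h.
    by rewrite -uc; apply: (between_row u c) => //; lia.
  have := col m mP; have := row m mP.
  have := trap c (-1) (-1) _ _ col row m c mP cP.
  move: lc; rewrite /level => lc /(_ (or_intror erefl) (or_intror erefl)).
  by lia.
- move=> c cP lc; apply: contrapT => /not_orP[/negP right_ /negP above].
  have [_ mc1 _ mc2] := box c cP.
  have col u : u \in P -> u.1 = c.1 -> 1 * (u.2 - c.2) <= 0.
    move=> uP uc; rewrite leNgt; apply: contra above => h.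
    by apply: (between_col c u) => //; lia.
  have row u : u \in P -> u.2 = c.2 -> 1 * (u.1 - c.1) <= 0.
    move=> uP uc; rewrite leNgt; apply: contra right_ => h.
    by apply: (between_row c u) => //; lia.
  have := col M MP; have := row M MP.
  have := trap c 1 1 _ _ col row M c MP cP.
  move: lc; rewrite /level => lc /(_ (or_introl erefl) (or_introl erefl)).
  by lia.
- move=> c d x cP dP lcd /andP[cx xd]; apply: contrapT => /negP pP.
  set p : cell := (x, _) in pP.
  have p1 : p.1 = x by [].
  have p2 : p.2 = level c - x by [].
  clearbody p.
  have col : exists2 e2 : int, e2 = 1 \/ e2 = -1 &
      forall u, u \in P -> u.1 = p.1 -> e2 * (u.2 - p.2) <= 0.
    have [[u [uP up pu]] | noabove] :=
        pselect (exists u, [/\ u \in P, u.1 = p.1 & p.2 <= u.2]).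
      exists (-1); first by right.
      move=> w wP wp; rewrite leNgt; apply: contra pP => h.
      by rewrite [p]surjective_pairing -wp; apply: (between_col w u) => //; lia.
    exists 1; first by left.
    move=> u uP up; rewrite leNgt; apply/negP => h.
    by apply: noabove; exists u; split => //; lia.
  have row : exists2 e1 : int, e1 = 1 \/ e1 = -1 &
      forall u, u \in P -> u.2 = p.2 -> e1 * (u.1 - p.1) <= 0.
    have [[u [uP up pu]] | noright] :=
        pselect (exists u, [/\ u \in P, u.2 = p.2 & p.1 <= u.1]).
      exists (-1); first by right.
      move=> w wP wp; rewrite leNgt; apply: contra pP => h.
      by rewrite [p]surjective_pairing -wp; apply: (between_row w u) => //; lia.
    exists 1; first by left.
    move=> u uP up; rewrite leNgt; apply/negP => h.
    by apply: noright; exists u; split => //; lia.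
  have off u : u \in P -> level u = level c -> u.1 != p.1.
    move=> uP lu; apply: contra pP => /eqP up.
    by have -> : p = u by apply: cell_eq => //; move: lu; rewrite /level in p2 *; lia.
  have [e1 he1 {}row] := row; have [e2 he2 {}col] := col.
  have {}trap := trap p e1 e2 he1 he2 col row.
  have oc := off c cP erefl; have od := off d dP (esym lcd).
  have [mc1 cM1 mc2 cM2] := box c cP; have [md1 dM1 md2 dM2] := box d dP.
  (* The quadrants are, in this order, NE, SE, NW and SW. *)
  case: he1 he2 => e1E [] e2E; subst e1 e2.
  - have := trap M c MP cP; have := off M MP; have := col M MP; have := row M MP.
    by rewrite /level in p2 lcd *; lia.
  - by have := trap d c dP cP; rewrite /level in p2 lcd *; lia.
  - by have := trap c d cP dP; rewrite /level in p2 lcd *; lia.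
  - have := trap m c mP cP; have := off m mP; have := col m mP; have := row m mP.
    by rewrite /level in p2 lcd *; lia.
Qed.

Lemma climb m M P c (l : int) : staircase m M P -> c \in P ->
  level c <= l <= level M ->
  exists d, [/\ d \in P, level d = l, c.1 <= d.1 & c.2 <= d.2].
Proof.
move=> PS cP /andP[cl lM].
elim: {cl}`|l - level c|%N {-2}c cP (erefl `|l - level c|%N) cl => [|n IHn] {}c cP cn cl.
  by exists c; split => //; lia.
have [||cP' | cP'] := step_up _ _ _ PS c => //; first by lia.
  have [||d [dP dl d1 d2]] := IHn _ cP'; first by move: cn cl; rewrite /level /=; lia.
    by move: cn cl; rewrite /level /=; lia.
  by exists d; move: d1 d2 => /=; split => //; lia.
have [||d [dP dl d1 d2]] := IHn _ cP'; first by move: cn cl; rewrite /level /=; lia.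
  by move: cn cl; rewrite /level /=; lia.
by exists d; move: d1 d2 => /=; split => //; lia.
Qed.

Lemma descend m M P c (l : int) : staircase m M P -> c \in P ->
  level m <= l <= level c ->
  exists d, [/\ d \in P, level d = l, d.1 <= c.1 & d.2 <= c.2].
Proof.
move=> PS cP /andP[ml cl].
elim: {cl}`|level c - l|%N {-2}c cP (erefl `|level c - l|%N) cl => [|n IHn] {}c cP cn cl.
  by exists c; split => //; lia.
have [||cP' | cP'] := step_down _ _ _ PS c => //; first by lia.
  have [||d [dP dl d1 d2]] := IHn _ cP'; first by move: cn cl; rewrite /level /=; lia.
    by move: cn cl; rewrite /level /=; lia.
  by exists d; move: d1 d2 => /=; split => //; lia.
have [||d [dP dl d1 d2]] := IHn _ cP'; first by move: cn cl; rewrite /level /=; lia.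
  by move: cn cl; rewrite /level /=; lia.
by exists d; move: d1 d2 => /=; split => //; lia.
Qed.

Lemma staircase_box m M P c : staircase m M P -> c \in P ->
  [/\ m.1 <= c.1, c.1 <= M.1, m.2 <= c.2 & c.2 <= M.2].
Proof.
move=> PS cP; have /andP[mc cM] := level_bounds _ _ _ PS c cP.
have [|d [dP dl d1 d2]] := climb _ _ _ c (level M) PS cP; first by lia.
have [|e [eP el e1 e2]] := descend _ _ _ c (level m) PS cP; first by lia.
by rewrite -(top_unique _ _ _ PS d dP dl) -(bottom_unique _ _ _ PS e eP el).
Qed.

Lemma staircase_bounds m M P : staircase m M P ->
  [/\ xmin P = m.1, xmax P = M.1, ymin P = m.2 & ymax P = M.2].
Proof.
move=> PS; apply: bounds_unique; [exact: bottom_in PS | exact: top_in PS |].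
by move=> c /(staircase_box _ _ _ _ PS)[-> -> -> ->].
Qed.

Lemma lower_neighbour m M P c : staircase m M P -> c \in P ->
  level m < level c ->
  exists d, [/\ d \in P, adjacent c d, adjacent d c & level d = level c - 1].
Proof.
move=> PS cP mc; have [//|dP|dP] := step_down _ _ _ PS c cP.
  by exists (c.1 - 1, c.2); rewrite /adjacent /level /=; split=> //; lia.
by exists (c.1, c.2 - 1); rewrite /adjacent /level /=; split=> //; lia.
Qed.

Lemma staircase_connected m M P : staircase m M P -> connected_cells P.
Proof.
move=> PS.
have to_bottom c : c \in P -> exists s : seq cell,
    [/\ path adjacent c s, last c s = m & {subset s <= P}].
  elim: {c}`|level c - level m|%N {-2}c (erefl `|level c - level m|%N)
    => [|n IHn] c cn cP; have /andP[mc cM] := level_bounds _ _ _ PS c cP.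
    by exists [::]; split => //=; apply: (bottom_unique _ _ _ PS) => //; lia.
  have [|d [dP dc _ ld]] := lower_neighbour _ _ _ c PS cP; first by lia.
  have [|s [ds sm sP]] := IHn d _ dP; first by lia.
  exists (d :: s); split => //=; first by rewrite dc.
  by move=> u; rewrite inE => /predU1P[-> | /sP].
have from_bottom c : c \in P -> exists s : seq cell,
    [/\ path adjacent m s, last m s = c & {subset s <= P}].
  elim: {c}`|level c - level m|%N {-2}c (erefl `|level c - level m|%N)
    => [|n IHn] c cn cP; have /andP[mc cM] := level_bounds _ _ _ PS c cP.
    exists [::]; split => //=.
    by apply/esym; apply: (bottom_unique _ _ _ PS) => //; lia.
  have [|d [dP _ dc ld]] := lower_neighbour _ _ _ c PS cP; first by lia.
  have [|s [ds sm sP]] := IHn d _ dP; first by lia.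
  exists (rcons s c); split; rewrite ?rcons_path ?last_rcons ?sm ?ds //.
  by move=> u; rewrite mem_rcons inE => /predU1P[-> | /sP].
move=> c d /to_bottom[s [cs sm sP]] /from_bottom[s' [ms s'd s'P]].
exists (s ++ s'); split; rewrite ?cat_path ?last_cat ?sm ?cs //.
by move=> u; rewrite mem_cat => /orP[/sP | /s'P].
Qed.

(** For the cells (x1, y) and (x2, y) of a row and x between x1 and x2, climbing
    from the first and descending from the second to the level of (x, y) gives
    two cells of its antidiagonal, one on each side; convexity of antidiagonals
    concludes. Columns are alike. *)
Lemma parallelogram_of_staircase m M P : staircase m M P -> parallelogram_cells P.
Proof.
move=> PS; have [xm xM ym yM] := staircase_bounds _ _ _ PS.
have conv := antidiagonal_convex _ _ _ PS.
split.
- by apply/fset0Pn; exists m; exact: bottom_in PS.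
- exact: staircase_connected PS.
- move=> x1 x x2 y cP dP /andP[cx xd].
  have /andP[_ dM] := level_bounds _ _ _ PS _ dP.
  have /andP[mc _] := level_bounds _ _ _ PS _ cP.
  rewrite /level /= in mc dM.
  have [|u [uP ul u1 u2]] := climb _ _ _ _ (x + y) PS cP; first by rewrite /level /=; lia.
  have [|v [vP vl v1 v2]] := descend _ _ _ _ (x + y) PS dP; first by rewrite /level /=; lia.
  have -> : y = level u - x by lia.
  by apply: (conv u v) => //; rewrite /level /= in ul vl u2 v2 *; lia.
- move=> x y1 y y2 cP dP /andP[cy yd].
  have /andP[_ dM] := level_bounds _ _ _ PS _ dP.
  have /andP[mc _] := level_bounds _ _ _ PS _ cP.
  rewrite /level /= in mc dM.
  have [|u [uP ul u1 u2]] := climb _ _ _ _ (x + y) PS cP; first by rewrite /level /=; lia.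
  have [|v [vP vl v1 v2]] := descend _ _ _ _ (x + y) PS dP; first by rewrite /level /=; lia.
  have -> : y = level v - x by lia.
  by apply: (conv v u) => //; rewrite /level /= in ul vl u1 v1 *; lia.
- by rewrite xm ym -surjective_pairing; exact: bottom_in PS.
- by rewrite xM yM -surjective_pairing; exact: top_in PS.
Qed.

(** * Twisting the upper half *)

(** The reflection in the line of direction y = x through [p]. *)
Definition swap_at p c : cell := (p.1 + (c.2 - p.2), p.2 + (c.1 - p.1)).

(** The sum of the lowest and the highest levels: comparing twice a level with it
    avoids halving. *)
Definition double_mid P : int := xmin P + ymin P + (xmax P + ymax P).

Definition middle P : {fset cell} :=
  [fset c in P | (level c + level c == double_mid P)%R]%fset.

(** The bounding rectangle of a contiguous block of an antidiagonal is a square,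
    so that the perpendicular bisector of the block is the line of direction
    y = x through this corner. *)
Definition corner P : cell := (xmin (middle P), ymin (middle P)).

Definition bend P c : cell :=
  if level c + level c <= double_mid P then c else swap_at (corner P) c.

Definition twist P : {fset cell} := [fset bend P c | c in P]%fset.

Lemma level_swap_at p c : level (swap_at p c) = level c.
Proof. by rewrite /level /=; lia. Qed.

Lemma swap_atK p : involutive (swap_at p).
Proof. by move=> c; apply: cell_eq => /=; lia. Qed.

Lemma bendK P : involutive (bend P).
Proof.
move=> c; rewrite {2}/bend; case: ifP => low; rewrite /bend; first by rewrite low.
by rewrite level_swap_at low swap_atK.
Qed.

Lemma in_twist P c : (c \in twist P) = (bend P c \in P).
Proof.
apply/imfsetP/idP => [[d dP ->] | cP]; first by rewrite bendK.
by exists (bend P c); rewrite ?bendK.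
Qed.

Lemma card_twist P : #|` twist P| = #|` P|.
Proof. by rewrite card_imfset //; exact: inv_inj (bendK P). Qed.

(** Some map with linear part [g] sends [P] into itself, hence onto itself by
    finiteness; see [transl_equiv_invariant]. *)
Definition invariant_under (g : cell -> cell) P : Prop :=
  exists v, forall c, c \in P -> g c + v \in P.

Section Twist.

(* The middle level exists exactly when the half-perimeter is even; it is [h]
   below. *)

Variables (m M q : cell) (P : {fset cell}) (h : int).
Hypotheses (PS : staircase m M P) (mMh : level m + level M = h + h :> int)
  (qE : corner P = q).

Lemma mid_between : level m <= h <= level M.
Proof.
by have /andP[mM _] := level_bounds _ _ _ PS _ (top_in _ _ _ PS); lia.
Qed.

Lemma double_midE : double_mid P = h + h.
Proof.
have [xm xM ym yM] := staircase_bounds _ _ _ PS.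
by rewrite /double_mid xm xM ym yM -mMh.
Qed.

Lemma in_middle c : (c \in middle P) = (c \in P) && (level c == h).
Proof.
rewrite !inE double_midE; congr (_ && _).
by apply/eqP/eqP; lia.
Qed.

Lemma corner_middle :
  [/\ forall c, c \in P -> level c = h ->
        q.1 <= c.1 /\ q.2 <= c.2,
      exists2 c : cell, c \in P & level c = h /\ c.1 = q.1 &
      exists2 c : cell, c \in P & level c = h /\ c.2 = q.2].
Proof.
have [c [cP ch _ _]] := climb _ _ _ _ h PS (bottom_in _ _ _ PS) mid_between.
have B0 : middle P != fset0 by apply/fset0Pn; exists c; rewrite in_middle cP ch eqxx.
have [[a aB a1] _ [b bB b2] _] := bounds_attained _ B0.
rewrite -qE /corner; split=> /=.
- move=> d dP dh; have dB : d \in middle P by rewrite in_middle dP dh eqxx.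
  by have [] := bounds_le _ _ dB.
- by move: aB; rewrite in_middle => /andP[aP /eqP ah]; exists a.
- by move: bB; rewrite in_middle => /andP[bP /eqP bh]; exists b.
Qed.

(** The two halves of the twist fit together because the reflection maps the
    middle block to itself. *)
Lemma swap_middle c : c \in P -> level c = h -> swap_at q c \in P.
Proof.
move=> cP ch; have [low [a aP [ah a1]] [b bP [bh b2]]] := corner_middle.
have [c1 c2] := low c cP ch.
set x := q.1 + (c.2 - q.2).
have -> : swap_at q c = (x, level a - x).
  by apply: cell_eq => //=; rewrite ah -ch /level /x; lia.
by apply: (antidiagonal_convex _ _ _ PS a b); rewrite // /level /x in ah bh ch *; lia.
Qed.

Lemma in_twist_low c : level c <= h -> (c \in twist P) = (c \in P).
Proof. by move=> ch; rewrite in_twist /bend qE double_midE ifT //; lia. Qed.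

Lemma in_twist_high c : h <= level c ->
  (c \in twist P) = (swap_at q c \in P).
Proof.
move=> hc; rewrite in_twist /bend qE double_midE; case: ifP => // low.
have ch : level c = h by lia.
apply/idP/idP => [cP | /swap_middle]; first exact: swap_middle.
by rewrite level_swap_at swap_atK; apply.
Qed.

Lemma twist_staircase : staircase m (swap_at q M) (twist P).
Proof.
have /andP[mh hM] := mid_between.
have inT c : c \in twist P -> exists2 d : cell, d \in P & level c = level d /\
    c = if level d <= h then d else swap_at q d.
  rewrite in_twist => bP; exists (bend P c) => //.
  rewrite /bend qE double_midE; case: ifPn => low.
    by split=> //; rewrite ifT //; lia.
  by rewrite level_swap_at ifF ?swap_atK //; lia.
split.
- by rewrite in_twist_low //; exact: bottom_in PS.
- by rewrite in_twist_high ?level_swap_at // swap_atK; exact: top_in PS.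
- move=> c /inT[d dP [-> _]]; rewrite level_swap_at.
  exact: (level_bounds _ _ _ PS).
- move=> c /inT[d dP [-> cd]] dm; have dE := bottom_unique _ _ _ PS d dP dm.
  by rewrite cd dE mh.
- move=> c cT; rewrite level_swap_at => cM.
  move: cT; rewrite in_twist_high ?cM // => cP.
  by rewrite -(top_unique _ _ _ PS _ cP) ?swap_atK // level_swap_at.
- move=> c cT mc; have [ch | hc] := leP (level c) h.
    rewrite !in_twist_low; [|by move: ch; rewrite /level /=; lia..].
    by apply: (step_down _ _ _ PS) => //; rewrite -in_twist_low.
  rewrite !in_twist_high; [|by move: hc; rewrite /level /=; lia..].
  rewrite in_twist_high in cT; last by lia.
  have [|cP|cP] := step_down _ _ _ PS _ cT; first by rewrite level_swap_at.
    right; apply: (pair_in _ _ _ _ cP) => /=; lia.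
  left; apply: (pair_in _ _ _ _ cP) => /=; lia.
- move=> c cT mc; rewrite level_swap_at in mc; have [ch | hc] := ltP (level c) h.
    rewrite !in_twist_low; [|by move: ch; rewrite /level /=; lia..].
    by apply: (step_up _ _ _ PS) => //; rewrite -in_twist_low //; lia.
  rewrite !in_twist_high; [|by move: hc; rewrite /level /=; lia..].
  rewrite in_twist_high in cT; last by lia.
  have [|cP|cP] := step_up _ _ _ PS _ cT; first by rewrite level_swap_at.
    right; apply: (pair_in _ _ _ _ cP) => /=; lia.
  left; apply: (pair_in _ _ _ _ cP) => /=; lia.
- move=> c d x cT dT cd /andP[cx xd]; have [ch | hc] := leP (level c) h.
    rewrite in_twist_low; last by rewrite /level /= in ch *; lia.
    by apply: (antidiagonal_convex _ _ _ PS c d);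
      rewrite -?in_twist_low //; rewrite /level in cd ch cx xd *; lia.
  rewrite in_twist_high in cT; last by lia.
  rewrite in_twist_high in dT; last by lia.
  rewrite in_twist_high; last by rewrite /level /= in hc *; lia.
  have := antidiagonal_convex _ _ _ PS _ _ (q.1 + (level c - x - q.2)) dT cT.
  rewrite !level_swap_at => /(_ (esym cd)) inP.
  apply: (pair_in _ _ _ _ (inP _)) => //=; rewrite /level in cd *; lia.
Qed.

Lemma double_mid_twist : double_mid (twist P) = double_mid P.
Proof.
have [xm xM ym yM] := staircase_bounds _ _ _ twist_staircase.
by rewrite double_midE /double_mid xm xM ym yM -mMh /level /=; lia.
Qed.

Lemma middle_twist : middle (twist P) = middle P.
Proof.
apply/fsetP => c; rewrite in_middle !inE double_mid_twist double_midE.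
have -> : (level c + level c == h + h) = (level c == h) by apply/eqP/eqP; lia.
by apply: andb_id2r => /eqP ch; rewrite in_twist_low ?ch.
Qed.

Lemma twistK : twist (twist P) = P.
Proof.
have bendE c : bend (twist P) c = bend P c.
  by rewrite /bend /corner double_mid_twist middle_twist.
by apply/fsetP => c; rewrite !in_twist bendE bendK.
Qed.

(** The symmetry exchanges the lowest and the highest levels, which determines
    the component of its translation part along y = x. *)
Lemma sym_level g v : (forall c, level (g c) = - level c) ->
  (forall c, c \in P -> g c + v \in P) -> level v = h + h.
Proof.
move=> lg gP.
have := level_bounds _ _ _ PS _ (gP m (bottom_in _ _ _ PS)).
have := level_bounds _ _ _ PS _ (gP M (top_in _ _ _ PS)).
have lD c : level (g c + v) = level v - level c.
  by have := lg c; rewrite /level /=; lia.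
by rewrite !lD; lia.
Qed.

(** Let [D c = g c + v] be a symmetry of [P] that exchanges the two halves, and
    [s] the reflection that commutes with it. The twist of [P] consists of the
    lower half of [P] and of the image under [s] of its upper half, so it is
    stable under the composite of [D] and [s]. *)
Lemma twist_invariant g g' v w :
    (forall c, level (g c + v) = h + h - level c) ->
    (forall c, swap_at q (g' c + w) = g c + v) ->
    (forall c, g' c + w = g (swap_at q c) + v) ->
    (forall c, c \in P -> g c + v \in P) ->
  forall c, c \in twist P -> g' c + w \in twist P.
Proof.
move=> lD sD Ds DP c.
have lD' : level (g' c + w) = h + h - level c by rewrite Ds lD level_swap_at.
have [ch | hc] := leP (level c) h.
  rewrite in_twist_low // in_twist_high; last by rewrite lD'; lia.
  by rewrite sD; exact: DP.
rewrite in_twist_high; last by lia.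
rewrite in_twist_low; last by rewrite lD'; lia.
by rewrite Ds; exact: DP.
Qed.

Lemma twist_d1 : invariant_under d1 P -> invariant_under r2 (twist P).
Proof.
case=> v DP; have lv : level v = h + h.
  by apply: (sym_level d1) => // c; rewrite /level /=; lia.
have [low [a aP [ah a1]] [b bP [bh b2]]] := corner_middle.
(* On the middle level the symmetry is a translation along the antidiagonal; it
   preserves the bounds of the finite middle block, hence is the identity. *)
have vE : v = (h, h).
  have [|la _] := low _ (DP a aP); first by move: lv ah; rewrite /level /=; lia.
  have [|_ lb] := low _ (DP b bP); first by move: lv bh; rewrite /level /=; lia.
  by move: la lb lv ah bh; rewrite /level => /= *; apply: cell_eq => /=; lia.
exists (h + q.1 - q.2, h - q.1 + q.2).
apply: (twist_invariant d1 r2 v) DP => c; rewrite vE.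
- by rewrite /level /=; lia.
- by apply: cell_eq => /=; lia.
- by apply: cell_eq => /=; lia.
Qed.

Lemma twist_r2 : invariant_under r2 P -> invariant_under d1 (twist P).
Proof.
case=> v DP; have lv : level v = h + h.
  by apply: (sym_level r2) => // c; rewrite /level /=; lia.
have [low [a aP [ah a1]] [b bP [bh b2]]] := corner_middle.
(* The half-turn reverses the middle block, so its centre is the centre of the
   bounding square of the block. *)
have vE : v = (h + q.1 - q.2, h - q.1 + q.2).
  have [|_ la] := low _ (DP a aP); first by move: lv ah; rewrite /level /=; lia.
  have [|lb _] := low _ (DP b bP); first by move: lv bh; rewrite /level /=; lia.
  by move: la lb lv ah bh; rewrite /level => /= *; apply: cell_eq => /=; lia.
exists (h, h).
apply: (twist_invariant r2 d1 v) DP => c; rewrite vE.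
- by rewrite /level /=; lia.
- by apply: cell_eq => /=; lia.
- by apply: cell_eq => /=; lia.
Qed.

End Twist.

(** * Translation invariance *)

Lemma in_translate v P c : (c \in translate v P) = (c - v \in P).
Proof.
apply/imfsetP/idP => [[d dP ->] | cP]; first by rewrite addrK.
by exists (c - v); rewrite ?subrK.
Qed.

Lemma card_translate v P : #|` translate v P| = #|` P|.
Proof. by rewrite card_imfset //; exact: addIr. Qed.

Lemma translate_eq0 v P : P != fset0 -> translate v P != fset0.
Proof.
by case/fset0Pn => c cP; apply/fset0Pn; exists (c + v); rewrite in_translate addrK.
Qed.

Lemma bounds_translate v P : P != fset0 ->
  [/\ xmin (translate v P) = xmin P + v.1, xmax (translate v P) = xmax P + v.1,
      ymin (translate v P) = ymin P + v.2 & ymax (translate v P) = ymax P + v.2].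
Proof.
move=> P0.
have [[a aP a1] [b bP b1] [c cP c1] [d dP d1']] := bounds_attained P P0.
have [[a' aQ a1'] [b' bQ b1'] [c' cQ c1'] [d' dQ d2]] :=
  bounds_attained _ (translate_eq0 v _ P0).
have up u : u \in P -> u + v \in translate v P by rewrite in_translate addrK.
have [/= le_a _ _ _] := bounds_le _ _ (up _ aP).
have [/= _ le_b _ _] := bounds_le _ _ (up _ bP).
have [/= _ _ le_c _] := bounds_le _ _ (up _ cP).
have [/= _ _ _ le_d] := bounds_le _ _ (up _ dP).
rewrite !in_translate in aQ bQ cQ dQ.
have [/= le_a' _ _ _] := bounds_le _ _ aQ.
have [/= _ le_b' _ _] := bounds_le _ _ bQ.
have [/= _ _ le_c' _] := bounds_le _ _ cQ.
have [/= _ _ _ le_d'] := bounds_le _ _ dQ.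
by split; lia.
Qed.

Lemma level_sub c v : level (c - v) = level c - level v.
Proof. by rewrite /level /=; lia. Qed.

Lemma staircase_translate v m M P :
  staircase m M P -> staircase (m + v) (M + v) (translate v P).
Proof.
move=> PS; have lD c : level (c + v) = level c + level v by rewrite /level /=; lia.
have lB := level_sub^~ v.
split.
- by rewrite in_translate addrK; exact: bottom_in PS.
- by rewrite in_translate addrK; exact: top_in PS.
- by move=> c; rewrite in_translate => /(level_bounds _ _ _ PS); rewrite lB !lD; lia.
- move=> c; rewrite in_translate => cP; rewrite lD => cm.
  by rewrite -(bottom_unique _ _ _ PS _ cP) ?subrK // lB cm addrK.
- move=> c; rewrite in_translate => cP; rewrite lD => cm.
  by rewrite -(top_unique _ _ _ PS _ cP) ?subrK // lB cm addrK.
- move=> c; rewrite !in_translate lD => cP lc.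
  have [|dP|dP] := step_down _ _ _ PS _ cP; first by rewrite lB; lia.
    by left; apply: (pair_in _ _ _ _ dP) => /=; lia.
  by right; apply: (pair_in _ _ _ _ dP) => /=; lia.
- move=> c; rewrite !in_translate lD => cP lc.
  have [|dP|dP] := step_up _ _ _ PS _ cP; first by rewrite lB; lia.
    by left; apply: (pair_in _ _ _ _ dP) => /=; lia.
  by right; apply: (pair_in _ _ _ _ dP) => /=; lia.
- move=> c d x; rewrite !in_translate => cP dP cd xcd.
  have := antidiagonal_convex _ _ _ PS _ _ (x - v.1) cP dP; rewrite !lB => dia.
  apply: (pair_in _ _ _ _ (dia _ _)) => /=; rewrite ?cd //; first by lia.
  by rewrite /level /=; lia.
Qed.

Lemma parallelogram_cells_translate v P :
  parallelogram_cells P -> parallelogram_cells (translate v P).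
Proof.
move=> /staircase_of_parallelogram/(staircase_translate v).
exact: parallelogram_of_staircase.
Qed.

Lemma twist_translate v P : P != fset0 -> middle P != fset0 ->
  twist (translate v P) = translate v (twist P).
Proof.
move=> P0 B0; have [xm xM ym yM] := bounds_translate v P P0.
have midE : double_mid (translate v P) = double_mid P + (level v + level v) :> int.
  by rewrite /double_mid xm xM ym yM /level; lia.
have middleE : middle (translate v P) = translate v (middle P).
  apply/fsetP => c; rewrite in_translate !inE in_translate midE; congr (_ && _).
  by rewrite level_sub; apply/eqP/eqP; lia.
have [bxm _ bym _] := bounds_translate v (middle P) B0.
have cornerE : corner (translate v P) = corner P + v.
  by rewrite /corner middleE; apply: cell_eq.
apply/fsetP => c; rewrite in_translate !in_twist in_translate; congr (_ \in P).
rewrite /bend midE cornerE level_sub; move: (corner P) => q.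
have -> : (level c + level c <= double_mid P + (level v + level v)) =
  (level c - level v + (level c - level v) <= double_mid P) by apply/idP/idP; lia.
by case: ifP => // _; apply: cell_eq => /=; lia.
Qed.

Lemma invariant_translate (g : cell -> cell) w P :
  {morph g : c d / c + d} -> invariant_under g P ->
  invariant_under g (translate w P).
Proof.
move=> gD [v gP]; exists (v + w - g w) => c; rewrite !in_translate => /gP.
congr (_ \in P); have -> : g c = g (c - w) + g w by rewrite -gD subrK.
by move: (g _) (g w) => a b; apply: cell_eq => /=; lia.
Qed.

(** One inclusion suffices, since both sides have as many cells. *)
Lemma transl_equiv_invariant (g : cell -> cell) P : injective g ->
  transl_equiv (g @` P)%fset P <-> invariant_under g P.
Proof.
move=> gI; split=> [/asboolP[v PE] | [v gP]].
  exists v => c cP; rewrite PE in_translate addrK; exact: in_imfset.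
apply/asboolP; exists v; apply/esym/eqP; rewrite eqEfcard; apply/andP; split.
  apply/fsubsetP => c; rewrite in_translate => /imfsetP[d dP dE].
  by rewrite -(subrK v c) dE; exact: gP.
by rewrite card_translate card_imfset.
Qed.

(** * The involution on figures *)

Implicit Type F : figure.

Lemma repr_pi P : exists v, repr (\pi_figure P)%qT = translate v P.
Proof.
have /eqquotP/asboolP[v PE] : (\pi_figure (repr (\pi_figure P)) = \pi_figure P)%qT.
  by rewrite reprK.
by exists (- v); rewrite [in RHS]PE translateD subrr translate0.
Qed.

Lemma pi_translate v P : (\pi_figure (translate v P) = \pi_figure P)%qT.
Proof.
by apply/eqquotP; rewrite transl_equiv_sym; apply/asboolP; exists v.
Qed.

(** The width and the height both count a cell once more than the coordinate
    differences, whence the 2. *)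
Lemma half_perimeter_staircase F m M : staircase m M (repr F) ->
  (half_perimeter F)%:Z = level M - level m + 2 :> int.
Proof.
move=> PS; have [xm xM ym yM] := staircase_bounds _ _ _ PS.
have [? ? ? ?] := staircase_box _ _ _ _ PS (bottom_in _ _ _ PS).
by rewrite /half_perimeter /width /height xm xM ym yM /level; lia.
Qed.

Definition twist_figure F : figure := (\pi_figure (twist (repr F)))%qT.

Lemma r2D : {morph r2 : c d / c + d}.
Proof. by move=> c d; apply: cell_eq => /=; lia. Qed.

Lemma d1D : {morph d1 : c d / c + d}.
Proof. by move=> c d; apply: cell_eq => /=; lia. Qed.

Lemma r2K : involutive r2.
Proof. by move=> c; apply: cell_eq => /=; lia. Qed.

Lemma d1K : involutive d1.
Proof. by move=> c; apply: cell_eq => /=; lia. Qed.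

Lemma d1_invariant_square P : parallelogram_cells P -> invariant_under d1 P ->
  xmax P - xmin P = ymax P - ymin P :> int.
Proof.
move=> [_ _ _ _ mP MP] [v DP].
have [/= ? ? ? ?] := bounds_le _ _ (DP _ mP).
have [/= ? ? ? ?] := bounds_le _ _ (DP _ MP).
by lia.
Qed.

Lemma d1_square F : parallelogram F -> symmetric_under d1 F -> width F = height F.
Proof.
move=> PF /(transl_equiv_invariant _ _ (inv_inj d1K)) DF.
by rewrite /width /height (d1_invariant_square _ PF DF).
Qed.

Lemma d1_half_perimeter F : parallelogram F -> symmetric_under d1 F ->
  ~~ odd (half_perimeter F).
Proof.
by move=> PF DF; rewrite /half_perimeter (d1_square F PF DF) addnn odd_double.
Qed.

Section EvenHalfPerimeter.

Variables (F : figure) (k : nat).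
Hypotheses (PF : parallelogram F) (Fk : half_perimeter F = (2 * k)%N).

Lemma even_staircase : exists m M (h : int),
  staircase m M (repr F) /\ level m + level M = h + h :> int.
Proof.
have PS := staircase_of_parallelogram _ PF.
exists (xmin (repr F), ymin (repr F)), (xmax (repr F), ymax (repr F)).
exists (k%:Z - 1 + level (xmin (repr F), ymin (repr F))); split=> //.
by have := half_perimeter_staircase _ _ _ PS; rewrite Fk; lia.
Qed.

Lemma twist_figure_parallelogram : parallelogram (twist_figure F).
Proof.
have [m [M [h [PS mMh]]]] := even_staircase.
have [v QE] := repr_pi (twist (repr F)); rewrite /parallelogram /= QE.
apply: parallelogram_cells_translate.
exact: parallelogram_of_staircase (twist_staircase _ _ _ _ _ PS mMh erefl).
Qed.

Lemma twist_figure_half_perimeter : half_perimeter (twist_figure F) = (2 * k)%N.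
Proof.
have [m [M [h [PS mMh]]]] := even_staircase.
have [v QE] := repr_pi (twist (repr F)).
have TS := twist_staircase _ _ _ _ _ PS mMh erefl.
have := staircase_translate v _ _ _ TS; rewrite -QE.
move=> /half_perimeter_staircase hT; have := half_perimeter_staircase _ _ _ PS.
have lD c : level (c + v) = level c + level v by rewrite /level /=; lia.
by move: hT; rewrite Fk -/(twist_figure F) !lD level_swap_at; lia.
Qed.

Lemma twist_figureK : twist_figure (twist_figure F) = F.
Proof.
have [m [M [h [PS mMh]]]] := even_staircase.
have [v QE] := repr_pi (twist (repr F)).
have TS := twist_staircase _ _ _ _ _ PS mMh erefl.
rewrite /twist_figure QE twist_translate; first last.
- have [c [cP ch _ _]] := climb _ _ _ _ h PS (bottom_in _ _ _ PS) (mid_between _ _ _ _ PS mMh).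
  rewrite (middle_twist _ _ _ _ _ PS mMh erefl).
  by apply/fset0Pn; exists c; rewrite (in_middle _ _ _ _ PS mMh) cP ch eqxx.
- by apply/fset0Pn; exists m; exact: bottom_in TS.
by rewrite pi_translate (twistK _ _ _ _ _ PS mMh erefl) reprK.
Qed.

Lemma twist_figure_d1 :
  symmetric_under d1 F -> symmetric_under r2 (twist_figure F).
Proof.
have [m [M [h [PS mMh]]]] := even_staircase.
have [v QE] := repr_pi (twist (repr F)).
move=> /(transl_equiv_invariant _ _ (inv_inj d1K)) DP.
apply/(transl_equiv_invariant _ _ (inv_inj r2K)); rewrite QE.
apply: invariant_translate r2D _.
exact: (twist_d1 _ _ _ _ _ PS mMh erefl).
Qed.

Lemma twist_figure_r2 :
  symmetric_under r2 F -> symmetric_under d1 (twist_figure F).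
Proof.
have [m [M [h [PS mMh]]]] := even_staircase.
have [v QE] := repr_pi (twist (repr F)).
move=> /(transl_equiv_invariant _ _ (inv_inj r2K)) DP.
apply/(transl_equiv_invariant _ _ (inv_inj d1K)); rewrite QE.
apply: invariant_translate d1D _.
exact: (twist_r2 _ _ _ _ _ PS mMh erefl).
Qed.

End EvenHalfPerimeter.

Lemma twist_figure_area F : area (twist_figure F) = area F.
Proof.
have [v QE] := repr_pi (twist (repr F)).
by rewrite /area QE card_translate card_twist.
Qed.

Lemma twist_figure_bij k : set_bij
  [set F | [/\ parallelogram F, symmetric_under d1 F
              & half_perimeter F = (2 * k)%N]]%classic
  [set F | [/\ parallelogram F, symmetric_under r2 F
              & half_perimeter F = (2 * k)%N]]%classic
  twist_figure.
Proof.
split.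
- move=> F [PF DF Fk]; split.
  + exact: twist_figure_parallelogram PF Fk.
  + exact: twist_figure_d1 PF Fk DF.
  + exact: twist_figure_half_perimeter PF Fk.
- move=> F G; rewrite !inE => -[PF _ Fk] [PG _ Gk] FG.
  by rewrite -(twist_figureK F k PF Fk) FG (twist_figureK G k PG Gk).
- move=> F [PF DF Fk]; exists (twist_figure F); last exact: twist_figureK PF Fk.
  split.
  + exact: twist_figure_parallelogram PF Fk.
  + exact: twist_figure_r2 PF Fk DF.
  + exact: twist_figure_half_perimeter PF Fk.
Qed.

(** * Generating series *)

Lemma area_poly0 : area_poly set0%classic = 0.
Proof. exact: fsbig_set0. Qed.

Lemma D1E w h : D1 w h =
  if w == h then
    area_poly [set F | [/\ parallelogram F, symmetric_under d1 F
                          & half_perimeter F = (w + h)%N]]%classic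
  else 0.
Proof.
rewrite /D1; case: eqP => [-> | wh]; last first.
  rewrite -area_poly0; congr (area_poly _); apply/seteqP.
  by split=> // F [PF DF Fw Fh]; apply: wh; rewrite -Fw -Fh; exact: d1_square.
congr (area_poly _); apply/seteqP; split=> F.
  by case=> PF DF Fw Fh; split; rewrite // /half_perimeter Fw Fh.
case=> PF DF; rewrite /half_perimeter (d1_square F PF DF) !addnn => /double_inj Fh.
by split; rewrite ?d1_square.
Qed.

Lemma area_poly_d1_r2 k :
  area_poly [set F | [/\ parallelogram F, symmetric_under d1 F
                        & half_perimeter F = (2 * k)%N]]%classic
  = r (2 * k).
Proof.
rewrite /r /area_poly (reindex_fsbig _ _ _ _ (twist_figure_bij k)).
by apply: eq_fsbigr => F _; rewrite twist_figure_area.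
Qed.

Theorem mainTheorem6 :
  (* equality of the coefficients of t^n, for all n *)
  (forall n : nat, subst_tt D1 n = \sum_(k < n.+1 | (2 * k)%N == n) r (2 * k)%N) /\
  (forall F : figure, parallelogram F -> symmetric_under d1 F ->
     ~~ odd (half_perimeter F)) /\
  (forall k a : nat, exists f : figure -> figure,
     set_bij
       [set F : figure | [/\ parallelogram F, symmetric_under d1 F,
                             half_perimeter F = (2 * k)%N & area F = a]]%classic
       [set F : figure | [/\ parallelogram F, symmetric_under r2 F,
                             half_perimeter F = (2 * k)%N & area F = a]]%classic
       f).
Proof.
split; last split; last first.
- move=> k a; exists twist_figure; have [maps inj surj] := twist_figure_bij k.
  split.
  + move=> F [PF DF Fk Fa]; have [//|PT DT Tk] := maps F _.
    by split; rewrite ?twist_figure_area.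
  + by move=> F G; rewrite !inE => -[? ? ? _] [? ? ? _]; apply: inj; rewrite inE.
  + move=> F [PF DF Fk Fa]; have [//|G [PG DG Gk] GF] := surj F.
    by exists G => //; split; rewrite // -twist_figure_area GF.
- exact: d1_half_perimeter.
move=> n; rewrite /subst_tt; under eq_bigr => i _ do rewrite D1E.
rewrite -big_mkcond; apply: eq_big => i /=.
  by have := ltn_ord i; move=> ?; apply/eqP/eqP; lia.
move=> /eqP i_half; rewrite -area_poly_d1_r2.
by have -> : (i + (n - i) = 2 * i)%N by lia.
Qed.
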